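(* Let $\mathcal{L}$ be a finite algebraic language and let $\mathcal{Q}$ be a locally finite $\mathcal{L}$-quasivariety. (a) The following are equivalent for any set of $\mathcal{L}$-clauses $\Lambda$: (i) For each finite $\mathbf{B} \in \mathcal{Q}$: $\mathbf{B} \in \mathbb{IS}(\mathbf{F}_{\mathcal{Q}})$ if and only if $\mathbf{B}$ satisfies $\Lambda$. (ii) $\Lambda$ is a basis for the admissible clauses of $\mathcal{Q}$. (b) The following are equivalent for any set of $\mathcal{L}$-quasi-identities $\Lambda$: (iii) For each finite $\mathbf{B} \in \mathcal{Q}$: $\mathbf{B} \in \mathbb{ISP}(\mathbf{F}_{\mathcal{Q}})$ if and only if $\mathbf{B}$ satisfies $\Lambda$. (iv) $\Lambda$ is a basis for the admissible quasi-identities of $\mathcal{Q}$.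
   Context: An identity is an ordered pair of formulas, written $\varphi\approx\psi$. A clause is an ordered pair $\Sigma\Rightarrow\Delta$ of finite (possibly empty) sets of identities, read as the universal closure of ''the conjunction of $\Sigma$ implies the disjunction of $\Delta$'' (empty conjunction true, empty disjunction false); it is a quasi-identity if $|\Delta|=1$. An algebra satisfies a set of clauses if it satisfies each of its members. A universal class (resp. quasivariety) is the class of all $\mathcal{L}$-algebras satisfying some set of clauses (resp. quasi-identities). $\mathbb{U}(\mathcal{K})$ and $\mathbb{Q}(\mathcal{K})$ denote the smallest universal class and smallest quasivariety containing $\mathcal{K}$. A quasivariety is locally finite if its finitely generated members are finite. $\mathbf{F}_{\mathcal{Q}}$ is the free algebra of $\mathcal{Q}$ on countably infinitely many generators. $\mathbb{I},\mathbb{S},\mathbb{P}$ are the class operators of taking isomorphic images, subalgebras, and direct products (including the empty product, a trivial algebra). All algebras are non-empty. A set $\Lambda$ of clauses is a basis for the admissible clauses of $\mathcal{Q}$ if $\mathbb{U}(\mathbf{F}_{\mathcal{Q}})$ is axiomatized by $\Lambda$ relative to $\mathcal{Q}$, i.e. for every algebra $\mathbf{A}$: $\mathbf{A}\in\mathbb{U}(\mathbf{F}_{\mathcal{Q}})$ iff $\mathbf{A}\in\mathcal{Q}$ and $\mathbf{A}$ satisfies $\Lambda$. A set $\Lambda$ of quasi-identities is a basis for the admissible quasi-identities of $\mathcal{Q}$ if $\mathbb{Q}(\mathbf{F}_{\mathcal{Q}})$ is axiomatized by $\Lambda$ relative to $\mathcal{Q}$ in the same sense. *)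

(* Defs.v *)
From HB Require Import structures.
From mathcomp Require Import all_boot finmap all_classical.
Set Implicit Arguments.
Unset Strict Implicit.
Unset Printing Implicit Defensive.
Local Open Scope classical_set_scope.
Local Open Scope quotient_scope.

(* The symbols form a finType: only finite languages are considered. *)
Record language := Language { symbol : finType; arity : symbol -> nat }.

Record algebra (L : language) := Algebra {
  carrier :> Type;
  op : forall f : symbol L, ('I_(arity f) -> carrier) -> carrier;
  carrier_inhabited : inhabited carrier }.
Arguments op {L} A f a : rename.

(* A plain predicate rather than a [set], so that no universe of the library
   of classical sets is forced above the universe of the carriers. *)
Definition algebra_class (L : language) := algebra L -> Prop.

Inductive term (L : language) :=
  | Var of nat
  | App (f : symbol L) of 'I_(arity f) -> term L.
Arguments Var {L} n.
Arguments App {L} f ts.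

HB.instance Definition _ L := gen_eqMixin (term L).
HB.instance Definition _ L := gen_choiceMixin (term L).

Section Satisfaction.
Variable L : language.
Implicit Types (A : algebra L) (K V : algebra_class L).

Definition identity : choiceType := (term L * term L)%type.

Record clause := Clause { premises : {fset identity}; conclusions : {fset identity} }.

Definition quasi_identity : set clause := [set c | (#|` conclusions c|%fset = 1)%N].

Fixpoint eval A (v : nat -> A) (t : term L) : A :=
  match t with
  | Var n => v n
  | App f ts => op A f (fun i => eval v (ts i))
  end.

Definition holds A (v : nat -> A) (e : identity) : Prop := eval v e.1 = eval v e.2.

Definition satisfies_clause A (c : clause) : Prop :=
  forall v : nat -> A, (forall e, e \in premises c -> holds v e) ->
    exists2 e, e \in conclusions c & holds v e.

Definition satisfies A (Lam : set clause) : Prop :=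
  forall c, Lam c -> satisfies_clause A c.

Definition axiomatized_by K (Lam : set clause) : Prop :=
  forall A, K A <-> satisfies A Lam.

Definition universal_class K : Prop := exists Lam, axiomatized_by K Lam.

Definition quasivariety K : Prop :=
  exists2 Lam, Lam `<=` quasi_identity & axiomatized_by K Lam.

(* The intersections of all universal classes, respectively quasivarieties,
   containing K. *)
Definition gen_universal_class K : algebra_class L :=
  fun A => forall V, universal_class V -> (forall B, K B -> V B) -> V A.

Definition gen_quasivariety K : algebra_class L :=
  fun A => forall V, quasivariety V -> (forall B, K B -> V B) -> V A.

End Satisfaction.
Arguments clause : clear implicits.
Arguments quasi_identity : clear implicits.

Section Operators.
Variable L : language.
Implicit Types (A B : algebra L) (K : algebra_class L).

Definition hom A B (h : A -> B) : Prop :=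
  forall f (a : 'I_(arity f) -> A), h (op A f a) = op B f (h \o a).

Definition isomorphic A B : Prop := exists2 h : A -> B, hom h & bijective h.

Definition closed_under_ops A (U : set A) : Prop :=
  forall f (a : 'I_(arity f) -> A), (forall i, U (a i)) -> U (op A f a).

Lemma subalgebra_inhabited A (U : set A) : U !=set0 -> inhabited {x : A | U x}.
Proof. by case=> x Ux; exists; exists x. Qed.

Definition subalgebra A (U : set A) (clU : closed_under_ops U) (U0 : U !=set0) :
  algebra L :=
  @Algebra L {x : A | U x}
    (fun f a => exist _ (op A f (fun i => proj1_sig (a i)))
                        (clU f _ (fun i => proj2_sig (a i))))
    (subalgebra_inhabited U0).

Lemma product_inhabited (I : Type) (A : I -> algebra L) :
  inhabited (forall i, A i).
Proof.
have ex i : exists x : A i, True by case: (carrier_inhabited (A i)) => x; exists x.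
by exists => i; exact: sval (cid (ex i)).
Qed.

Definition product (I : Type) (A : I -> algebra L) : algebra L :=
  @Algebra L (forall i, A i) (fun f a i => op (A i) f (fun j => a j i))
    (product_inhabited A).

Definition class_I K : algebra_class L :=
  fun A => exists2 B, K B & isomorphic B A.

Definition class_S K : algebra_class L :=
  fun A => exists B (U : set B) (clU : closed_under_ops U) (U0 : U !=set0),
    K B /\ A = subalgebra clU U0.

Definition class_P K : algebra_class L :=
  fun A => exists (I : Type) (B : I -> algebra L),
    (forall i, K (B i)) /\ A = product B.

Definition single A : algebra_class L := fun B => B = A.

Definition finite_algebra A : Prop := finite_set [set: A].

Definition finitely_generated A : Prop :=
  exists2 G : set A, finite_set G & smallest (@closed_under_ops A) G = setT.

Definition locally_finite K : Prop :=
  forall A, K A -> finitely_generated A -> finite_algebra A.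

End Operators.

Section FreeAlgebra.
Variables (L : language) (Q : algebra_class L).

(* The free algebra of Q is the term algebra modulo the identities valid in Q. *)
Definition term_equiv (s t : term L) : bool :=
  `[< forall A, Q A -> forall v : nat -> A, eval v s = eval v t >].

Lemma term_equiv_refl : reflexive term_equiv.
Proof. by move=> s; apply/asboolP. Qed.

Lemma term_equiv_sym : symmetric term_equiv.
Proof.
by move=> s t; apply/asboolP/asboolP => st A QA v; rewrite (st A QA).
Qed.

Lemma term_equiv_trans : transitive term_equiv.
Proof.
move=> t s u /asboolP st /asboolP tu; apply/asboolP => A QA v.
by rewrite (st A QA) (tu A QA).
Qed.

Canonical term_equiv_rel :=
  EquivRel term_equiv term_equiv_refl term_equiv_sym term_equiv_trans.

Definition free_carrier := {eq_quot term_equiv_rel}.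

Definition free_generator (n : nat) : free_carrier := \pi_free_carrier (Var n).

Definition free_algebra : algebra L :=
  @Algebra L free_carrier
    (fun f a => \pi_free_carrier (App f (fun i => repr (a i))))
    (inhabits (free_generator 0)).

Lemma free_eqP (s t : term L) :
  \pi_free_carrier s = \pi_free_carrier t <->
  forall A, Q A -> forall v : nat -> A, eval v s = eval v t.
Proof. by split=> [/eqmodP/asboolP|st]; last apply/eqmodP/asboolP. Qed.

Lemma free_op_pi (f : symbol L) (ts : 'I_(arity f) -> term L) :
  op free_algebra f (fun i => \pi_free_carrier (ts i)) = \pi_free_carrier (App f ts).
Proof.
apply/free_eqP => A QA v /=; congr (op A f _); apply: funext => i.
by apply: ((free_eqP _ _).1 _ A QA v); rewrite reprK.
Qed.

Lemma free_algebra_in : quasivariety Q -> Q free_algebra.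
Proof.
move=> [Lam qLam QE]; apply/QE => c Lc w wprem.
pose s n := repr (w n : free_carrier).
pose sub := fix sub (t : term L) : term L :=
  match t with Var n => s n | App f ts => App f (fun i => sub (ts i)) end.
have evalE t : eval w t = \pi_free_carrier (sub t).
  elim: t => [n|f ts IH]; first by rewrite /= /s reprK.
  rewrite -[RHS]free_op_pi; change (eval w (App f ts)) with
    (op free_algebra f (fun i => eval w (ts i))).
  by congr (op free_algebra f _); apply: funext => i; apply: IH.
have subE (A : algebra L) (v : nat -> A) t : eval v (sub t) = eval (fun n => eval v (s n)) t.
  elim: t => [n|f ts IH] //=; congr (op A f _).
  by apply: funext => i; apply: IH.
have /cardfs1P[e ce] : (#|` conclusions c|%fset == 1)%N by rewrite (qLam c Lc).
exists e; first by rewrite ce inE.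
rewrite /holds !evalE; apply/free_eqP => A QA v; rewrite !subE.
have /QE/(_ c Lc (fun n => eval v (s n)))[e' e'prem|e'] := QA.
  have := wprem _ e'prem; rewrite /holds !evalE => /free_eqP/(_ A QA v).
  by rewrite !subE.
by rewrite ce inE => /eqP ->.
Qed.

Lemma free_algebra_universal (A : algebra L) (v : nat -> A) : Q A ->
  exists2 h : free_algebra -> A, hom h & forall n, h (free_generator n) = v n.
Proof.
move=> QA; pose h (x : free_carrier) := eval v (repr x).
have hpi t : h (\pi_free_carrier t) = eval v t.
  by apply: ((free_eqP _ _).1 _ A QA v); rewrite reprK.
by exists h => [f a|n]; rewrite ?hpi.
Qed.

Lemma free_algebra_generated (U : set free_algebra) :
  closed_under_ops U -> (forall n, U (free_generator n)) -> U = setT.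
Proof.
move=> clU Ugen; apply/seteqP; split=> // x _; rewrite -[x]reprK.
elim: (repr x) => [n|f ts IH]; first exact: Ugen.
by rewrite -free_op_pi; apply: clU.
Qed.

Definition basis_admissible_clauses (Lam : set (clause L)) : Prop :=
  forall A, gen_universal_class (single free_algebra) A <-> Q A /\ satisfies A Lam.

Definition basis_admissible_quasi_identities (Lam : set (clause L)) : Prop :=
  forall A, gen_quasivariety (single free_algebra) A <-> Q A /\ satisfies A Lam.

End FreeAlgebra.

(* Main.v *)
Require Import Defs.
From mathcomp Require Import all_boot finmap all_classical.

(* The theory of F_Q includes the axioms of Q, and two facts reduce both parts
   to finite algebras. Since a clause involves finitely many variables, a member
   of Q satisfies it iff its finitely generated, hence finite, subalgebras do.
   And for finite B, the clauses whose premises are the positive diagram of B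
   show that B satisfies the clauses of F iff it embeds in F, and the
   quasi-identities of F iff homomorphisms to F separate its points, i.e. iff
   it embeds in a power of F. *)

Set Implicit Arguments.
Unset Strict Implicit.
Unset Printing Implicit Defensive.
Local Open Scope classical_set_scope.

(** * Preservation of clauses under embeddings and products *)

Section Homomorphisms.
Variable L : language.
Implicit Types (A B : algebra L) (K : algebra_class L) (T : set (clause L)).

Lemma hom_eval A B (h : A -> B) : hom h ->
  forall v t, h (eval v t) = eval (h \o v) t.
Proof.
move=> hh v; elim=> [//|f ts IH] /=; rewrite hh; congr (op B f _).
by apply: funext => i; apply: IH.
Qed.

Lemma embedding_satisfies A B (h : B -> A) T : hom h -> injective h ->
  satisfies A T -> satisfies B T.
Proof.
move=> hh injh AT c Tc v prem.
have [e /prem|e ec he] := AT c Tc (h \o v).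
  by rewrite /holds -!hom_eval // => ->.
by exists e => //; apply: injh; rewrite !(hom_eval hh).
Qed.

(** A single conclusion holds in the product as soon as it holds in each coordinate; with several,
    different coordinates might satisfy different ones. *)
Lemma product_satisfies I (A : I -> algebra L) T : T `<=` quasi_identity L ->
  (forall i, satisfies (A i) T) -> satisfies (product A) T.
Proof.
move=> qT AT c Tc v prem.
have evalE i t : eval v t i = eval (fun n => v n i) t.
  by apply: (@hom_eval (product A) (A i) (fun x => x i)).
have /cardfs1P[e ce] : (#|` conclusions c|%fset == 1)%N by rewrite (qT c Tc).
exists e; first by rewrite ce inE.
apply: functional_extensionality_dep => i; rewrite !evalE.
have [e' /prem he'|e'] := AT i c Tc (fun n => v n i).
  by rewrite /holds -!evalE he'.
by rewrite ce inE => /eqP ->.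
Qed.

Lemma subalgebra_val_inj A (U : set A) (clU : closed_under_ops U) U0 :
  injective (fun x : subalgebra clU U0 => sval x).
Proof.
by move=> x y; apply: eq_sig_hprop => z p q; apply: Prop_irrelevance.
Qed.

Lemma class_IS_embedding K B : class_I (class_S K) B <->
  exists2 A, K A & exists2 h : B -> A, hom h & injective h.
Proof.
split=> [[_ [A [U [clU [U0 [KA ->]]]]] [g hg [g' gK g'K]]]|[A KA [h hh injh]]].
  exists A => //; exists (fun b => sval (g' b)) => [f a|b b' /subalgebra_val_inj eb].
    have -> // : g' (op B f a) = op (subalgebra clU U0) f (g' \o a).
    rewrite -[RHS]gK hg; congr (g' (op B f _)); apply: funext => i /=.
    by rewrite g'K.
  by rewrite -(g'K b) -(g'K b') eb.
have clU : closed_under_ops (range h).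
  move=> f a ra; have /choice[b ab] : forall i, exists b, h b = a i.
    by move=> i; have [b _ <-] := ra i; exists b.
  by exists (op B f b) => //; rewrite hh; congr (op A f _); apply: funext.
have U0 : range h !=set0 by have [b] := carrier_inhabited B; exists (h b), b.
exists (subalgebra clU U0); first by exists A, (range h), clU, U0.
have /choice[g gP] : forall x : subalgebra clU U0, exists b, h b = sval x.
  by case=> x [b _ /= <-]; exists b.
exists g => [f a|].
  by apply: injh; rewrite gP hh; congr (op A f _); apply: funext => i /=; rewrite gP.
have hU b : range h (h b) by exists b.
exists (fun b => exist _ (h b) (hU b)) => [x|b].
  by apply: subalgebra_val_inj; apply: gP.
by apply: injh; rewrite gP.
Qed.

End Homomorphisms.

(** * Clauses from the diagram of a finite algebra *)

Section Diagram.
Variables (L : language) (B : algebra L).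
Hypothesis finB : finite_algebra B.

(* c P has the positive diagram of B as its premises, with variables naming the
   elements of B, and equates the pairs in P in its conclusions. *)
Lemma diagram_clause : exists c : set (B * B) -> clause L,
  (forall (A : algebra L) P, satisfies_clause A (c P) <->
     forall h : B -> A, hom h -> exists2 p, P p & h p.1 = h p.2) /\
  (forall p, quasi_identity L (c [set p])).
Proof.
have [b0] := carrier_inhabited B.
(* [{classic B}] supplies decidable equality, so that [B] can be listed as [s]. The variable naming
   [b] is its index [r b]; [e] reads it back, with [b0] as the default beyond the list. *)
have /finite_seqP[s sE] := finB : finite_set [set: {classic B}].
have sP b : b \in (s : seq {classic B}) by have : [set` s] b by rewrite -sE.
pose r (b : B) := index (b : {classic B}) s.
pose e (n : nat) : B := nth (b0 : {classic B}) s n.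
have rK b : e (r b) = b by exact: (nth_index _ (sP b)).
pose opid (x : {f : symbol L & 'I_(arity f) -> B}) : identity L :=
  (App (projT1 x) (fun i => Var (r (projT2 x i))), Var (r (op B (projT1 x) (projT2 x)))).
pose eqid (p : B * B) : identity L := (Var (r p.1), Var (r p.2)).
have finD : finite_set (range opid).
  (* There are finitely many symbols, and argument tuples are coded by indices into [s]; so [J] is a
     finite type whose image covers the diagram. *)
  pose J := {f : symbol L & {ffun 'I_(arity f) -> 'I_(size s)}}.
  pose g (x : J) := opid (existT _ (projT1 x) (fun i => e (projT2 x i))).
  apply: (@sub_finite_set _ _ (range g)); last first.
    exact/finite_image/finite_finset.
  move=> _ [[f a] _ <-].
  have ltr i : (r (a i) < size s)%N by rewrite index_mem.
  exists (existT _ f [ffun i => Ordinal (ltr i)] : J) => //.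
  rewrite /g /=; congr (opid (existT _ f _)); apply: funext => i.
  by rewrite ffunE /= rK.
have finE P : finite_set [set eqid p | p in P].
  apply/finite_image/(sub_finite_set (@subsetT _ P)).
  by rewrite -setXTT; apply: finite_setX.
exists (fun P => Clause (fset_set (range opid)) (fset_set [set eqid p | p in P])).
split=> [A P|p]; last by rewrite /quasi_identity /= image_set1 fset_set1 cardfs1.
split=> [cP h hh|cP w prem].
  have [q|q] := cP (h \o e).
    rewrite in_fset_set // inE => -[[f a] _ <-].
    rewrite /holds /= rK hh; congr (op A f _); apply: funext => i.
    by rewrite /= rK.
  rewrite in_fset_set // inE => -[p Pp <-].
  by rewrite /holds /= !rK => hp; exists p.
(* An assignment satisfying the diagram, read along the names [r], is a homomorphism. *)
have [|p Pp wp] := cP (w \o r).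
  move=> f a; have : opid (existT _ f a) \in fset_set (range opid).
    by rewrite in_fset_set // inE; exists (existT _ f a).
  by move=> /prem; rewrite /holds /= => <-.
by exists (eqid p) => //=; rewrite in_fset_set // inE; exists p.
Qed.

(** Let [P] consist of all pairs of distinct elements. If no homomorphism from [B] to [A] were
    injective, [A] would satisfy [c P], which the identity map refutes in [B]. *)
Lemma finite_universal_embedding (A : algebra L) :
  (forall c, satisfies_clause A c -> satisfies_clause B c) ->
  exists2 h : B -> A, hom h & injective h.
Proof.
move=> AB; have [c [cP _]] := diagram_clause.
pose P : set (B * B) := [set p | p.1 <> p.2].
apply: contrapT => noh.
have /AB/cP/(_ id) : satisfies_clause A (c P).
  apply/cP => h hh; apply: contrapT => noP; apply: noh; exists h => // b b' hb.
  by apply: contrapT => neq; apply: noP; exists (b, b').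
by case=> [f a|p]; [congr (op B f _)|].
Qed.

(** The same argument with one pair in the conclusion, which makes the diagram clause a
    quasi-identity. *)
Lemma finite_quasi_separation (A : algebra L) (b b' : B) :
  (forall c, quasi_identity L c -> satisfies_clause A c -> satisfies_clause B c) ->
  b <> b' -> exists2 h : B -> A, hom h & h b <> h b'.
Proof.
move=> AB neq; have [c [cP cq]] := diagram_clause.
apply: contrapT => noh.
have /(AB _ (cq _))/cP/(_ id) : satisfies_clause A (c [set (b, b')]).
  apply/cP => h hh; exists (b, b') => //=; apply: contrapT => hb.
  by apply: noh; exists h.
by case=> [f a|_ ->] //; congr (op B f _).
Qed.

End Diagram.

(** * Reduction to finitely generated subalgebras *)

Section LocalFiniteness.
Variable L : language.
Implicit Types (A B : algebra L) (T Lam : set (clause L)).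

Lemma eval_finitely_many_variables A (t : term L) : exists N, forall v w : nat -> A,
  (forall n, (n < N)%N -> v n = w n) -> eval v t = eval w t.
Proof.
elim: t => [n|f ts /choice[N NP]]; first by exists n.+1 => v w; apply.
exists (\max_i N i)%N => v w vw /=; congr (op A f _); apply: funext => i.
by apply: NP => n nN; apply/vw/(leq_trans nN)/leq_bigmax.
Qed.

Lemma holds_finitely_many_variables A (E : {fset identity L}) :
  exists N, forall v w : nat -> A, (forall n, (n < N)%N -> v n = w n) ->
    forall e, e \in E -> holds v e <-> holds w e.
Proof.
have /choice[N NP] := @eval_finitely_many_variables A.
exists (\max_(e <- E) maxn (N e.1) (N e.2))%N => v w vw e eE.
have le : (maxn (N e.1) (N e.2) <= \max_(e <- E) maxn (N e.1) (N e.2))%N.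
  exact: leq_bigmax_seq.
by rewrite /holds (NP e.1 v w) 1?(NP e.2 v w) // => n nN;
  apply/vw/leq_trans/le; rewrite leq_max nN ?orbT.
Qed.

Lemma generated_closed A (G : set A) :
  closed_under_ops (smallest (@closed_under_ops L A) G).
Proof. by move=> f a Ga U CU; apply: (proj1 CU) => i; exact: (Ga i U CU). Qed.

Lemma finitely_generated_subalgebra A (G : set A)
    (clU : closed_under_ops (smallest (@closed_under_ops L A) G)) U0 :
  finite_set G -> finitely_generated (subalgebra clU U0).
Proof.
move=> finG; pose val (x : subalgebra clU U0) : A := sval x.
have val_inj : injective val by exact: subalgebra_val_inj.
exists (val @^-1` G).
  by apply: finite_preimage => // x y _ _; apply: val_inj.
apply/seteqP; split=> // x _ V [clV GV].
(* The image of [V] in [A] is closed and contains [G], hence contains everything that [G]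
   generates. *)
have [y [Vy /val_inj <-]] // : [set z | exists y, V y /\ val y = z] (val x).
apply: (svalP x); split=> [f a Va|y Gy].
  have /choice[y yP] : forall i, exists y, V y /\ val y = a i by exact: Va.
  exists (op (subalgebra clU U0) f y); split; first by apply: clV => i; case: (yP i).
  by congr (op A f _); apply: funext => i; case: (yP i).
by exists (exist _ y (sub_gen_smallest Gy)); split=> //; apply: GV.
Qed.

Lemma subalgebra_inclusion A (U : set A) (clU : closed_under_ops U) U0 T :
  satisfies A T -> satisfies (subalgebra clU U0) T.
Proof.
apply: (@embedding_satisfies _ _ _ (fun x : subalgebra clU U0 => sval x)) => //.
exact: subalgebra_val_inj.
Qed.

Lemma satisfies_finitely_generated A T :
  (forall (U : set A) (clU : closed_under_ops U) (U0 : U !=set0),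
     finitely_generated (subalgebra clU U0) -> satisfies (subalgebra clU U0) T) ->
  satisfies A T.
Proof.
move=> fgT c Tc v prem.
have [N NP] := holds_finitely_many_variables A (premises c `|` conclusions c)%fset.
(* The bound [N.+1] puts [v 0] in [G] even when [N] is 0: [U] is then non-empty, and [w] can take
   the value [v 0] at the variables from [N] on. *)
pose G := v @` `I_N.+1; pose U := smallest (@closed_under_ops L A) G.
have clU : closed_under_ops U by exact: generated_closed.
pose w n := v (if (n < N)%N then n else 0).
have Uw n : U (w n).
  apply: sub_gen_smallest; rewrite /w; case: ifP => nN; last by exists 0.
  by exists n => //; apply: leqW.
have U0 : U !=set0 by exists (w 0).
have fgU : finitely_generated (subalgebra clU U0).
  exact/finitely_generated_subalgebra/finite_image/finite_II.
pose u n : subalgebra clU U0 := exist _ (w n) (Uw n).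
have uv e : e \in (premises c `|` conclusions c)%fset -> holds u e <-> holds v e.
  move=> ec; rewrite (NP v w) //; last by move=> n nN; rewrite /w nN.
  have evalE t : sval (eval u t) = eval w t.
    exact: (@hom_eval _ (subalgebra clU U0) A (fun x => sval x)).
  rewrite /holds -!evalE; split=> [->//|].
  exact: subalgebra_val_inj.
have [e ep|e ec /uv he] := fgT U clU U0 fgU c Tc u.
  by apply/uv; [rewrite inE ep|apply: prem].
by exists e => //; apply: he; rewrite inE ec orbT.
Qed.

(** Common core of both parts: [T] will be the clauses or quasi-identities true in the free algebra,
    and [K] the class IS or ISP of it. Finitely generated subalgebras of a member of [Q] lie in [Q]
    and are finite, so there [T] and [Lam] can be exchanged through [K]. *)
Lemma locally_finite_basis (Q K : algebra_class L) T Lam :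
  quasivariety Q -> locally_finite Q ->
  (forall A, satisfies A T -> Q A) ->
  (forall B, finite_algebra B -> K B <-> satisfies B T) ->
  (forall B, Q B -> finite_algebra B -> K B <-> satisfies B Lam) <->
  (forall A, satisfies A T <-> Q A /\ satisfies A Lam).
Proof.
move=> [Ax _ QE] lfQ TQ KT; split=> [KLam A|basis B QB finB]; last first.
  by rewrite KT // basis; split=> [[]|].
have QS (U : set A) (clU : closed_under_ops U) U0 : Q A -> Q (subalgebra clU U0).
  by move=> /QE QA; apply/QE; apply: subalgebra_inclusion.
split=> [AT|[QA ALam]].
  have QA := TQ _ AT; split=> //.
  apply: satisfies_finitely_generated => U clU U0 fgU.
  have QU := QS U clU U0 QA; have finU := lfQ _ QU fgU.
  by apply/KLam => //; apply/KT => //; apply: subalgebra_inclusion.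
apply: satisfies_finitely_generated => U clU U0 fgU.
have QU := QS U clU U0 QA; have finU := lfQ _ QU fgU.
by apply/KT => //; apply/KLam => //; apply: subalgebra_inclusion.
Qed.

End LocalFiniteness.

(** * Classes generated by one algebra and their finite members *)

Section Generation.
Variables (L : language) (F : algebra L).

Definition clause_theory : set (clause L) := [set c | satisfies_clause F c].

(** The theory of [F] axiomatizes a universal class containing [F], and it includes every axiom set
    of any other such class. *)
Lemma gen_universal_class_theory A :
  gen_universal_class (single F) A <-> satisfies A clause_theory.
Proof.
split=> [/(_ (fun B => satisfies B clause_theory))|AT V [Lam VE] VF].
  apply; first by exists clause_theory.
  by move=> _ -> c.
by apply/VE => c Lc; apply: AT; apply: (VE F).1 => //; apply: VF.
Qed.

Lemma gen_quasivariety_theory A : gen_quasivariety (single F) A <->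
  satisfies A (clause_theory `&` quasi_identity L).
Proof.
pose T := clause_theory `&` quasi_identity L.
split=> [/(_ (fun B => satisfies B T))|AT V [Lam qLam VE] VF].
  apply; first by exists T => // c [].
  by move=> _ -> c [].
apply/VE => c Lc; apply: AT; split; last exact: qLam.
by apply: (VE F).1 => //; apply: VF.
Qed.

Lemma finite_class_IS (B : algebra L) : finite_algebra B ->
  class_I (class_S (single F)) B <-> satisfies B clause_theory.
Proof.
move=> finB; rewrite class_IS_embedding; split=> [[_ -> [h hh injh]]|BT].
  by apply: (embedding_satisfies hh injh) => c.
by exists F => //; apply: finite_universal_embedding.
Qed.

Lemma finite_class_ISP (B : algebra L) : finite_algebra B ->
  class_I (class_S (class_P (single F))) B <->
  satisfies B (clause_theory `&` quasi_identity L).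
Proof.
move=> finB; rewrite class_IS_embedding; split.
  move=> [_ [I [A [AF ->]]] [h hh injh]].
  apply: (embedding_satisfies hh injh); apply: product_satisfies => [c []//|i].
  by rewrite AF => c [].
(* [B] embeds in the power of [F] with one coordinate per pair of distinct elements, chosen to
   separate that pair. For trivial [B] this is the empty product. *)
move=> BT; pose I := {p : B * B | p.1 <> p.2}.
have /choice[h hP] : forall i : I, exists h : B -> F,
    hom h /\ h (sval i).1 <> h (sval i).2.
  move=> i; have [|h hh hi] := @finite_quasi_separation L B finB F _ _ _ (svalP i).
    by move=> c qc Fc; apply: BT.
  by exists h.
exists (product (fun _ : I => F)); first by exists I, (fun=> F).
exists (fun b i => h i b) => [f a|b b' hb].
  by apply: functional_extensionality_dep => i; rewrite (hP i).1.
apply: contrapT => neq; pose i : I := exist _ (b, b') neq.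
by apply: (hP i).2; apply: (congr1 (fun x => x i) hb).
Qed.

End Generation.

Theorem lemma12 (L : language) (Q : algebra_class L)
    (hQ : quasivariety Q) (hlf : locally_finite Q) :
  (forall Lam : set (clause L),
     (forall B : algebra L, Q B -> finite_algebra B ->
        (class_I (class_S (single (free_algebra Q))) B <-> satisfies B Lam))
     <-> basis_admissible_clauses Q Lam) /\
  (forall Lam : set (clause L), Lam `<=` quasi_identity L ->
     (forall B : algebra L, Q B -> finite_algebra B ->
        (class_I (class_S (class_P (single (free_algebra Q)))) B <-> satisfies B Lam))
     <-> basis_admissible_quasi_identities Q Lam).
Proof.
have [Ax qAx QE] := hQ.
(* As the free algebra lies in [Q], its theory contains [Ax], so every model of the theory is in
   [Q]. *)
have FAx : satisfies (free_algebra Q) Ax by apply/QE; apply: free_algebra_in.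
have QT A T : satisfies A T -> Ax `<=` T -> Q A.
  by move=> AT AxT; apply/QE => c /AxT; apply: AT.
split=> [Lam|Lam _].
  rewrite (@locally_finite_basis _ _ _ (clause_theory (free_algebra Q))) //.
  - by split=> basis A; rewrite -basis gen_universal_class_theory.
  - by move=> A /QT; apply.
  - exact: finite_class_IS.
rewrite (@locally_finite_basis _ _ _
  (clause_theory (free_algebra Q) `&` quasi_identity L)) //.
- by split=> basis A; rewrite -basis gen_quasivariety_theory.
- by move=> A /QT; apply=> c Axc; split; [apply: FAx|apply: qAx].
- exact: finite_class_ISP.
Qed.
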